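(* Let $\mathcal{M}$ and $\mathcal{M}'$ be Kripke models with worlds $s$ of $\mathcal{M}$ and $s'$ of $\mathcal{M}'$ such that $(\mathcal{M},s)\rightleftharpoons(\mathcal{M}',s')$. Then for every formula $\psi\in\mathcal{L}_{glal}$, $$(\mathcal{M},s)\models\psi \iff (\mathcal{M}',s')\models\psi.$$ In particular, if $\psi=[\theta]^-_A\theta'$ (respectively $\psi=[\theta]^+_A\theta'$), then $\mathcal{M}^-_{(s,\theta,A)}\rightleftharpoons\mathcal{M}'^-_{(s',\theta,A)}$ (respectively $\mathcal{M}^+_{(s,\theta,A)}\rightleftharpoons\mathcal{M}'^+_{(s',\theta,A)}$).
   Context: Language. $AP$ is a set of atoms and $Ag$ a finite set of agents. The formulas of $\mathcal{L}_{glal}$ are given, for $p\in AP$ and $A\subseteq Ag$, by $\psi ::= p \mid \neg\psi \mid \psi\land\psi \mid C_A\psi \mid [\psi]^+_A\psi \mid [\psi]^-_A\psi$. Models. A (Kripke) model is $\mathcal{M}=\langle W,\{R_a\}_{a\in Ag},V\rangle$ with $W$ a set of worlds, each $R_a$ an equivalence relation on $W$, and $V:AP\to 2^W$. For $w\in W$, $R_a(w)=\{w' : R_a(w,w')\}$; for $A\subseteq Ag$, $R^C_A=(\bigcup_{a\in A}R_a)^*$ is the reflexive-transitive closure and $R^C_A(w)=\{w' : R^C_A(w,w')\}$. Semantics. The satisfaction set $[\![\varphi]\!]_{\mathcal{M}}\subseteq W$ is defined by: $[\![p]\!]_{\mathcal{M}}=V(p)$; $[\![\neg\psi]\!]_{\mathcal{M}}=W\setminus[\![\psi]\!]_{\mathcal{M}}$;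 $[\![\psi\land\psi']\!]_{\mathcal{M}}=[\![\psi]\!]_{\mathcal{M}}\cap[\![\psi']\!]_{\mathcal{M}}$; $[\![C_A\psi]\!]_{\mathcal{M}}=\{w : R^C_A(w)\subseteq[\![\psi]\!]_{\mathcal{M}}\}$; and for $\star\in\{+,-\}$, $[\![[\psi]^\star_A\psi']\!]_{\mathcal{M}}=\{w : \text{if } w\in[\![\psi]\!]_{\mathcal{M}} \text{ then } w\in[\![\psi']\!]_{\mathcal{M}^\star_{(w,\psi,A)}}\}$. The refinements $\mathcal{M}^-_{(w,\psi,A)}$ and $\mathcal{M}^+_{(w,\psi,A)}$ have the same worlds and valuation as $\mathcal{M}$ and relations $R^-_b=R^+_b=R_b$ for $b\notin A$, while for $a\in A$: $R^-_a(v)=R_a(v)\cap[\![\psi]\!]_{\mathcal{M}}$ if $v\in R_a(w)\cap[\![\psi]\!]_{\mathcal{M}}$; $R^-_a(v)=R_a(v)\cap[\![\neg\psi]\!]_{\mathcal{M}}$ if $v\in R_a(w)\cap[\![\neg\psi]\!]_{\mathcal{M}}$; $R^-_a(v)=R_a(v)$ otherwise; and $R^+_a(v)$ is defined by the same three cases with $R_a(w)$ replaced by $R^C_A(w)$ in the case conditions. We write $(\mathcal{M},w)\models\varphi$ for $w\in[\![\varphi]\!]_{\mathcal{M}}$. $\pm$-bisimulation. For $A\subseteq Ag$ (possibly empty), write $R_A(w,v)$ if for every $a\in Ag$: $R_a(w,v)$ iff $a\in A$ (i.e. $A$ is exactly the set of agents relating $w$ and $v$). Given models $\mathcal{M}=\langle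 W,\{R_a\},V\rangle$ and $\mathcal{M}'=\langle W',\{R'_a\},V'\rangle$, a $\pm$-simulation is a relation $\mathbf{S}\subseteq W\times W'$ such that $\mathbf{S}(w,w')$ implies: (Atoms) $w\in V(p)$ iff $w'\in V'(p)$ for every $p\in AP$; (Forth) for every $A\subseteq Ag$ and $v\in W$, if $R_A(w,v)$ then for some $v'\in W'$, $R'_A(w',v')$ and $\mathbf{S}(v,v')$; (Reach) if $\mathbf{S}(v,v')$, then for every $a\in Ag$, $R_a(w,v)$ iff $R'_a(w',v')$. A $\pm$-bisimulation is a relation $\mathbf{B}\subseteq W\times W'$ such that both $\mathbf{B}$ and $\mathbf{B}^{-1}$ are $\pm$-simulations. Worlds $w,w'$ are $\pm$-bisimilar, $w\rightleftharpoons w'$, if $\mathbf{B}(w,w')$ for some $\pm$-bisimulation $\mathbf{B}$. Models are $\pm$-bisimilar, $\mathcal{M}\rightleftharpoons\mathcal{M}'$, if every $w\in W$ is $\pm$-bisimilar to some $w'\in W'$ and every $w'\in W'$ is $\pm$-bisimilar to some $w\in W$. Finally $(\mathcal{M},w)\rightleftharpoons(\mathcal{M}',w')$ means $\mathcal{M}\rightleftharpoons\mathcal{M}'$ and $w\rightleftharpoons w'$. *)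

(* Defs.v *)
From Stdlib Require Import Relations.
From mathcomp Require Import all_boot.
From mathcomp Require Import boolp classical_sets.

Set Implicit Arguments.
Unset Strict Implicit.
Unset Printing Implicit Defensive.

Local Open Scope classical_set_scope.

Inductive formula (AP : Type) (Ag : finType) : Type :=
| Atom of AP
| Neg of formula AP Ag
| And of formula AP Ag & formula AP Ag
| Common of {set Ag} & formula AP Ag
(* [BoxPlus th A th'] is [th]^+_A th', [BoxMinus th A th'] is [th]^-_A th' *)
| BoxPlus of formula AP Ag & {set Ag} & formula AP Ag
| BoxMinus of formula AP Ag & {set Ag} & formula AP Ag.

(* [acc a w] is the set R_a(w), so [acc a w v] reads R_a(w, v). *)
Record model (AP : Type) (Ag : finType) := Model {
  world :> Type;
  acc : Ag -> world -> set world;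
  acc_equiv : forall a, equivalence _ (acc a);
  valuation : AP -> set world }.

Definition common_acc AP Ag (M : model AP Ag) (A : {set Ag}) (w : M) : set M :=
  clos_refl_trans M (fun x y => exists2 a, a \in A & acc a x y) w.

(* The three-case refinement of R_a: [P] is the truth set of the announced
   formula, and [D] is R_a(w) for M^- and R^C_A(w) for M^+. *)
Definition refine_along W (r : W -> set W) (D P : set W) (v : W) : set W :=
  if v \in D `&` P then r v `&` P
  else if v \in D `&` ~` P then r v `&` ~` P
  else r v.

Lemma refine_alongE W (r : W -> set W) (D P : set W) v u :
  refine_along r D P v u <-> r v u /\ (D v -> (P v <-> P u)).
Proof.
rewrite /refine_along; case: ifPn => [/set_mem[Dv Pv]|/negP nDP].
  by split=> [[rvu Pu]|[rvu /(_ Dv) [/(_ Pv)]]].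
case: ifPn => [/set_mem[Dv nPv]|/negP nDnP].
  split=> [[rvu nPu]|[rvu /(_ Dv) [_ Pvu]]]; first by split.
  by split=> // /Pvu.
split=> [rvu|[]//]; split=> // Dv.
by have [Pv|nPv] := pselect (P v); [case: nDP|case: nDnP]; apply/mem_set.
Qed.

Lemma refine_along_equiv W (r : W -> set W) (D P : set W) :
  equivalence _ r -> (forall x y, r x y -> D x -> D y) ->
  equivalence _ (refine_along r D P).
Proof.
move=> [rr rt rs] Dr; split.
- by move=> x; apply/refine_alongE; split=> //; exact: rr.
- move=> x y z /refine_alongE[rxy Pxy] /refine_alongE[ryz Pyz]; apply/refine_alongE.
  split; first exact: rt rxy ryz.
  move=> Dx; have [Pxy1 Pxy2] := Pxy Dx.
  by have [Pyz1 Pyz2] := Pyz (Dr _ _ rxy Dx); split=> ?; auto.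
- move=> x y /refine_alongE[rxy Pxy]; apply/refine_alongE; split; first exact: rs.
  by move=> Dy; have [] := Pxy (Dr _ _ (rs _ _ rxy) Dy).
Qed.

Section Refinement.
Variables (AP : Type) (Ag : finType) (M : model AP Ag).
Variables (w : M) (P : set M) (A : {set Ag}).

Definition acc_minus (a : Ag) : M -> set M :=
  if a \in A then refine_along (acc a) (acc a w) P else acc a.

Definition acc_plus (a : Ag) : M -> set M :=
  if a \in A then refine_along (acc a) (common_acc A w) P else acc a.

Lemma acc_minus_equiv a : equivalence _ (acc_minus a).
Proof.
rewrite /acc_minus; case: ifP => _; last exact: acc_equiv.
apply: refine_along_equiv => [|x y rxy rwx]; first exact: acc_equiv.
by have [_ rt _] := @acc_equiv _ _ M a; exact: rt rwx rxy.
Qed.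

Lemma acc_plus_equiv a : equivalence _ (acc_plus a).
Proof.
rewrite /acc_plus; case: ifPn => aA; last exact: acc_equiv.
apply: refine_along_equiv => [|x y rxy rwx]; first exact: acc_equiv.
by apply: rt_trans rwx _; apply: rt_step; exists a.
Qed.

Definition refine_minus : model AP Ag := Model acc_minus_equiv (@valuation _ _ M).
Definition refine_plus : model AP Ag := Model acc_plus_equiv (@valuation _ _ M).

End Refinement.

Unset Implicit Arguments.

Section Semantics.
Variables (AP : Type) (Ag : finType).

Fixpoint sem (psi : formula AP Ag) (M : model AP Ag) {struct psi} : set M :=
  match psi with
  | Atom p => valuation p
  | Neg f => ~` sem f M
  | And f g => sem f M `&` sem g M
  | Common A f => [set w | common_acc A w `<=` sem f M]
  | BoxPlus f A g =>
      [set w | sem f M w -> sem g (refine_plus w (sem f M) A) w]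
  | BoxMinus f A g =>
      [set w | sem f M w -> sem g (refine_minus w (sem f M) A) w]
  end.

End Semantics.

Arguments sem {AP Ag} psi M _.

Set Implicit Arguments.

Definition sat AP Ag (M : model AP Ag) (w : M) (psi : formula AP Ag) : Prop :=
  sem psi M w.
Arguments sat {AP Ag} M w psi.

Definition update_minus AP Ag (M : model AP Ag) (w : M) (psi : formula AP Ag)
  (A : {set Ag}) : model AP Ag := refine_minus w (sem psi M) A.
Arguments update_minus {AP Ag} M w psi A.

Definition update_plus AP Ag (M : model AP Ag) (w : M) (psi : formula AP Ag)
  (A : {set Ag}) : model AP Ag := refine_plus w (sem psi M) A.
Arguments update_plus {AP Ag} M w psi A.

(* [A] is exactly the set of agents relating [w] and [v]. *)
Definition acc_exact AP Ag (M : model AP Ag) (A : {set Ag}) (w v : M) : Prop :=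
  forall a, acc a w v <-> a \in A.

Record pm_simulation AP Ag (M M' : model AP Ag) (S : M -> M' -> Prop) : Prop :=
  PmSimulation {
  pm_atoms : forall w w', S w w' -> forall p, valuation p w <-> valuation p w';
  pm_forth : forall w w', S w w' -> forall (A : {set Ag}) (v : M),
    acc_exact A w v -> exists v', acc_exact A w' v' /\ S v v';
  pm_reach : forall w w', S w w' -> forall v v', S v v' ->
    forall a, acc a w v <-> acc a w' v' }.

Definition pm_bisimulation AP Ag (M M' : model AP Ag) (B : M -> M' -> Prop) :=
  pm_simulation B /\ pm_simulation (fun w' w => B w w').

Definition world_bisimilar AP Ag (M M' : model AP Ag) (w : M) (w' : M') :=
  exists B : M -> M' -> Prop, pm_bisimulation B /\ B w w'.

Definition model_bisimilar AP Ag (M M' : model AP Ag) :=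
  (forall w : M, exists w' : M', world_bisimilar w w') /\
  (forall w' : M', exists w : M, world_bisimilar w w').

Definition pointed_bisimilar AP Ag (M M' : model AP Ag) (w : M) (w' : M') :=
  model_bisimilar M M' /\ world_bisimilar w w'.

(* Main.v *)
Require Import Defs.
From mathcomp Require Import all_boot.
From Stdlib Require Import Relations.
From mathcomp Require Import boolp classical_sets.

(** Forth for the exact set of agents relating two worlds, possibly empty, makes
    every nonempty bisimulation total on both sides, so Forth reduces to totality
    and Reach.  Since Reach transports the domains R_a(s) and R^C_A(s) and the
    induction hypothesis transports the truth set of the announced formula, the
    same relation is a bisimulation between the refined models. *)

Section Bisimulation.
Local Set Implicit Arguments.
Local Unset Strict Implicit.
Variables (AP : Type) (Ag : finType).
Implicit Types M : model AP Ag.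

Lemma pm_simulation_total M M' (S : M -> M' -> Prop) s s' :
  pm_simulation S -> S s s' -> forall v, exists v', S v v'.
Proof.
move=> simS Sss' v.
have exact_sv : acc_exact [set a | `[< acc a s v >]] s v.
  by move=> a; rewrite inE; split=> [?|/asboolP//]; apply/asboolP.
by have [v' [_ Svv']] := pm_forth simS Sss' exact_sv; exists v'.
Qed.

(** Any image of [v] can serve as the Forth witness: Reach preserves the relations of all agents at
    once, hence the exact set of agents. *)
Lemma total_pm_simulation M M' (S : M -> M' -> Prop) :
  (forall w w', S w w' -> forall p, valuation p w <-> valuation p w') ->
  (forall v, exists v', S v v') ->
  (forall w w', S w w' -> forall v v', S v v' ->
     forall a, acc a w v <-> acc a w' v') ->
  pm_simulation S.
Proof.
move=> atS totS reachS; split=> // w w' Sww' A v exact_wv.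
have [v' Svv'] := totS v; exists v'; split=> // a.
by rewrite -exact_wv; split=> /(reachS _ _ Sww' _ _ Svv').
Qed.

Lemma total_pm_bisimulation M M' (B : M -> M' -> Prop) :
  (forall w w', B w w' -> forall p, valuation p w <-> valuation p w') ->
  (forall v, exists v', B v v') -> (forall v', exists v, B v v') ->
  (forall w w', B w w' -> forall v v', B v v' ->
     forall a, acc a w v <-> acc a w' v') ->
  pm_bisimulation B.
Proof.
move=> atB totB surB reachB; split; apply: total_pm_simulation => //.
- by move=> w' w Bww' p; split=> /(atB _ _ Bww').
- by move=> w' w Bww' v' v Bvv' a; split=> /(reachB _ _ Bww' _ _ Bvv').
Qed.

(** Induction on the closure: for a single edge, totality supplies some image of its endpoint and
    Reach makes that image a successor for the same agent. *)
Lemma common_acc_forth M M' (S : M -> M' -> Prop) (A : {set Ag}) w v w' :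
  pm_simulation S -> common_acc A w v -> S w w' ->
  exists2 v', common_acc A w' v' & S v v'.
Proof.
move=> simS wv; elim: wv w' => [x y [a aA xy]|x|x y z _ IHxy _ IHyz] w' Sxw'.
- have [y' Syy'] := pm_simulation_total simS Sxw' y.
  exists y' => //; apply: rt_step; exists a => //.
  exact/(pm_reach simS Sxw' Syy').
- by exists w' => //; exact: rt_refl.
- have [y' xy' Syy'] := IHxy _ Sxw'; have [z' yz' Szz'] := IHyz _ Syy'.
  by exists z' => //; exact: rt_trans xy' yz'.
Qed.

(* For [A] empty this fails: a world may be bisimilar to several worlds.
   Otherwise Reach, applied to the loop [acc a v v], links any two of them. *)
Lemma common_acc_reach M M' (S : M -> M' -> Prop) (A : {set Ag}) a w w' v v' :
  pm_simulation S -> a \in A -> S w w' -> S v v' ->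
  common_acc A w v -> common_acc A w' v'.
Proof.
move=> simS aA Sww' Svv' wv.
have [u' wu' Svu'] := common_acc_forth simS wv Sww'.
apply: rt_trans wu' _; apply: rt_step; exists a => //.
apply/(pm_reach simS Svu' Svv'); by have [refl_a _ _] := acc_equiv M a.
Qed.

(** The characterisation [refine_alongE] tests the domain only at the source, so agreement of [D]
    and [D'] at [v], [v'] is enough. *)
Lemma refine_along_iff W W' (r : W -> set W) (r' : W' -> set W')
    (D P : set W) (D' P' : set W') v v' u u' :
  (r v u <-> r' v' u') -> (D v <-> D' v') ->
  (P v <-> P' v') -> (P u <-> P' u') ->
  (refine_along r D P v u <-> refine_along r' D' P' v' u').
Proof. by move=> *; rewrite !refine_alongE; tauto. Qed.

Section Refinement.
Variables (M M' : model AP Ag) (B : M -> M' -> Prop) (s : M) (s' : M').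
Variables (P : set M) (P' : set M') (A : {set Ag}).
Hypotheses (bisB : pm_bisimulation B) (Bss' : B s s').
Hypothesis BP : forall w w', B w w' -> (P w <-> P' w').

Lemma refine_minus_bisimulation :
  @pm_bisimulation _ _ (refine_minus s P A) (refine_minus s' P' A) B.
Proof.
have [simB simB'] := bisB.
apply: total_pm_bisimulation.
- exact: (pm_atoms simB).
- exact: pm_simulation_total simB Bss'.
- exact: pm_simulation_total simB' Bss'.
move=> w w' Bww' v v' Bvv' a; rewrite /= /acc_minus.
case: ifP => _; last exact: (pm_reach simB).
(* Reach serves twice: at [w], [w'] for the relation itself, and at [s], [s'] for the domain
   [acc a s]. *)
by apply: refine_along_iff; [exact: (pm_reach simB)..|exact: BP|exact: BP].
Qed.

Lemma refine_plus_bisimulation :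
  @pm_bisimulation _ _ (refine_plus s P A) (refine_plus s' P' A) B.
Proof.
have [simB simB'] := bisB.
apply: total_pm_bisimulation.
- exact: (pm_atoms simB).
- exact: pm_simulation_total simB Bss'.
- exact: pm_simulation_total simB' Bss'.
move=> w w' Bww' v v' Bvv' a; rewrite /= /acc_plus.
(* Relations change only for agents of [A], so [aA] is at hand exactly where [common_acc_reach] asks
   for a member of [A]. *)
case: ifPn => aA; last exact: (pm_reach simB).
apply: refine_along_iff; [exact: (pm_reach simB)| |exact: BP|exact: BP].
split; first exact: common_acc_reach simB aA Bss' Bww'.
exact: common_acc_reach simB' aA Bss' Bww'.
Qed.

End Refinement.

(** The induction keeps the models and [B] general, because an update evaluates its subformula in
    the refined models. *)
Lemma sem_pm_bisimulation psi M M' (B : M -> M' -> Prop) :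
  pm_bisimulation B -> forall w w', B w w' -> (sem psi M w <-> sem psi M' w').
Proof.
elim: psi M M' B => [p|f IHf|f IHf g IHg|A f IHf|f IHf A g IHg|f IHf A g IHg]
  M M' B bisB w w' Bww' /=; have [simB simB'] := bisB.
- exact: (pm_atoms simB).
- by split=> nf /(IHf _ _ _ bisB _ _ Bww').
- by have := IHf _ _ _ bisB _ _ Bww'; have := IHg _ _ _ bisB _ _ Bww';
    rewrite /setI /=; tauto.
- split=> Cf v wv.
  + have [u wu Buv] := common_acc_forth simB' wv Bww'.
    exact/(IHf _ _ _ bisB _ _ Buv)/Cf.
  + have [u wu Bvu] := common_acc_forth simB wv Bww'.
    exact/(IHf _ _ _ bisB _ _ Bvu)/Cf.
(* The hypothesis for [f], used on all pairs of [B], keeps [B] a bisimulation after refinement; the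
   one for [g] is then applied between the refined models. *)
- have := IHg _ _ _ (refine_plus_bisimulation A bisB Bww'
    (IHf _ _ _ bisB)) _ _ Bww'.
  by have := IHf _ _ _ bisB _ _ Bww'; tauto.
- have := IHg _ _ _ (refine_minus_bisimulation A bisB Bww'
    (IHf _ _ _ bisB)) _ _ Bww'.
  by have := IHf _ _ _ bisB _ _ Bww'; tauto.
Qed.

(** By totality in both directions, [B] itself witnesses the bisimilarity of every world. *)
Lemma pm_bisimulation_model_bisimilar M M' (B : M -> M' -> Prop) s s' :
  pm_bisimulation B -> B s s' -> model_bisimilar M M'.
Proof.
move=> bisB Bss'; have [simB simB'] := bisB; split=> w.
- by have [w' Bww'] := pm_simulation_total simB Bss' w; exists w', B.
- by have [w' Bww'] := pm_simulation_total simB' Bss' w; exists w', B.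
Qed.

End Bisimulation.

Theorem theorem8 (AP : Type) (Ag : finType) (M M' : model AP Ag)
    (s : M) (s' : M') (hs : pointed_bisimilar s s') :
  forall psi : formula AP Ag,
    (sat M s psi <-> sat M' s' psi) /\
    (forall (th th' : formula AP Ag) (A : {set Ag}),
       psi = BoxMinus th A th' ->
       model_bisimilar (update_minus M s th A) (update_minus M' s' th A)) /\
    (forall (th th' : formula AP Ag) (A : {set Ag}),
       psi = BoxPlus th A th' ->
       model_bisimilar (update_plus M s th A) (update_plus M' s' th A)).
Proof.
case: hs => _ [B [bisB Bss']] psi.
have BP th := sem_pm_bisimulation th bisB.
split; first exact: BP.
split=> th _ A _.
- exact: pm_bisimulation_model_bisimilar
    (refine_minus_bisimulation A bisB Bss' (BP th)) Bss'.
- exact: pm_bisimulation_model_bisimilar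
    (refine_plus_bisimulation A bisB Bss' (BP th)) Bss'.
Qed.
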